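(* Let $G=\mathbb Z/2$ and let $\mathcal F$ be the collection of all subgroups of $G$. Then the Quillen adjunction $\theta_!:\mathbf S_G^{\mathcal F}\rightleftarrows[O_{\mathcal F},\mathbf S]_{inj}:\theta^*$, with $\theta_!(A)(G/H)=A/H$ and $\theta^*(T)=T(G/\{e\})$, is not a Quillen equivalence.
   Context: $\mathbf S$ is the category of simplicial sets with the Kan–Quillen model structure. $O_{\mathcal F}$ is the category whose objects are the left $G$-sets $G/H$ with $H\in\mathcal F$ and whose morphisms are $G$-equivariant maps; $\widetilde g:G/H\to G/K$ denotes the map $H\mapsto gK$. $[O_{\mathcal F},\mathbf S]_{inj}$ is the category of functors $O_{\mathcal F}\to\mathbf S$ with the injective model structure (weak equivalences and cofibrations objectwise). $\mathbf S_G$ is the category of simplicial sets with right $G$-action and $G$-equivariant maps. The functor $\theta_!(A)$ is given on objects by $G/H\mapsto A/H$ and on morphisms by $\theta_!(A)(\widetilde g)([a]_H)=[a\cdot g]_K$; it is left adjoint to $\theta^*(T)=T(G/\{e\})$, where the right $G$-action is induced by the automorphisms of $G/\{e\}$. $\mathbf S_G^{\mathcal F}$ denotes $\mathbf S_G$ with the model structure (which exists) in which $f$ is a weak equivalence (resp. cofibration) if and only if $\theta_!(f)$ is an objectwise weak equivalence (resp. objectwise cofibration); with this structure $(\theta_!\dashv\theta^* )$ is a Quillen adjunction. *)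

(* Defs.v *)
From HB Require Import structures.
From Stdlib Require Import Relation_Operators.
From mathcomp Require Import all_boot all_order all_algebra all_fingroup.
From mathcomp Require Import generic_quotient.
From mathcomp Require Import all_classical all_reals topology normedtype.

Set Implicit Arguments.
Unset Strict Implicit.
Unset Printing Implicit Defensive.

Import Order.TTheory GRing.Theory Num.Theory.
Import numFieldNormedType.Exports.

Local Open Scope classical_set_scope.
Local Open Scope quotient_scope.

Record category := Category {
  obj :> Type;
  hom : obj -> obj -> Type;
  idm : forall a, hom a a;
  compm : forall a b c, hom b c -> hom a b -> hom a c;
  comp1m : forall a b (f : hom a b), compm (idm b) f = f;
  compm1 : forall a b (f : hom a b), compm f (idm a) = f;
  compmA : forall a b c d (h : hom c d) (g : hom b c) (f : hom a b),
    compm h (compm g f) = compm (compm h g) f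
}.
Arguments hom {_} _ _.
Arguments idm {_} a.
Arguments compm {_ _ _ _} _ _.

Notation "g \oc f" := (compm g f) (at level 50, left associativity).

Definition op (C : category) : category :=
  @Category C (fun a b => @hom C b a) (fun a => idm a)
    (fun a b c g f => f \oc g)
    (fun a b f => compm1 f) (fun a b f => comp1m f)
    (fun a b c d h g f => esym (compmA f g h)).

Record functor (C D : category) := Functor {
  fobj :> C -> D;
  fmor : forall a b : C, hom a b -> hom (fobj a) (fobj b);
  fmor_id : forall a, fmor (idm a) = idm (fobj a);
  fmor_comp : forall a b c (g : hom b c) (f : hom a b),
    fmor (g \oc f) = fmor g \oc fmor f
}.
Arguments fmor {_ _} _ {_ _} _.

Record natTrans (C D : category) (F G : functor C D) := NatTrans {
  ntc :> forall a : C, hom (F a) (G a);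
  ntcE : forall a b (f : hom a b), ntc b \oc fmor F f = fmor G f \oc ntc a
}.

Lemma natTrans_eq (C D : category) (F G : functor C D) (s t : natTrans F G) :
  (forall a, s a = t a) -> s = t.
Proof.
case: s t => [s sE] [t tE] /= st.
have {}st : s = t by apply: functional_extensionality_dep.
by subst t; congr NatTrans; exact: Prop_irrelevance.
Qed.

Section FunctorCategory.
Variables C D : category.

Program Definition nt_id (F : functor C D) : natTrans F F :=
  @NatTrans C D F F (fun a => idm (F a)) _.
Next Obligation. by move=> F a b f /=; rewrite comp1m compm1. Qed.

Program Definition nt_comp (F G H : functor C D)
    (t : natTrans G H) (s : natTrans F G) : natTrans F H :=
  @NatTrans C D F H (fun a => t a \oc s a) _.
Next Obligation.
by move=> F G H t s a b f /=; rewrite -compmA ntcE compmA ntcE compmA.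
Qed.

Program Definition functorCat : category :=
  @Category (functor C D) (@natTrans C D) nt_id nt_comp _ _ _.
Next Obligation. by move=> *; apply: natTrans_eq => c /=; rewrite comp1m. Qed.
Next Obligation. by move=> *; apply: natTrans_eq => c /=; rewrite compm1. Qed.
Next Obligation. by move=> *; apply: natTrans_eq => x /=; rewrite compmA. Qed.

End FunctorCategory.

Record adjunction (C D : category) (F : functor C D) (U : functor D C) :=
  Adjunction {
    transpose : forall (A : C) (T : D), hom (F A) T -> hom A (U T);
    transpose_bij : forall A T, bijective (@transpose A T);
    transpose_natl : forall A A' T (f : hom (F A') T) (h : hom A A'),
      transpose (f \oc fmor F h) = transpose f \oc h;
    transpose_natr : forall A T T' (k : hom T T') (f : hom (F A) T),
      transpose (k \oc f) = fmor U k \oc transpose f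
  }.
Arguments transpose {_ _ _ _} _ {_ _} _.

Definition is_initial (C : category) (I : C) :=
  forall A : C, exists! f : hom I A, True.

Definition is_terminal (C : category) (Z : C) :=
  forall A : C, exists! f : hom A Z, True.

Definition rlp (C : category) (L : forall a b : C, hom a b -> Prop)
    (x y : C) (p : hom x y) :=
  forall (a b : C) (i : hom a b) (u : hom a x) (v : hom b y),
    L a b i -> p \oc u = v \oc i ->
    exists l : hom b x, l \oc i = u /\ p \oc l = v.

(* A model structure is determined by its weak equivalences and cofibrations:
   its fibrations are the maps having the right lifting property with respect
   to the trivial cofibrations. Only this data is recorded here; none of the
   notions below refers to the lifting and factorization axioms. *)
Record modelData (C : category) := ModelData {
  weq : forall a b : C, hom a b -> Prop;
  cof : forall a b : C, hom a b -> Prop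
}.
Arguments weq {_} _ {_ _} _.
Arguments cof {_} _ {_ _} _.

Section Model.
Variables (C : category) (M : modelData C).

Definition trivcof (a b : C) (f : hom a b) := cof M f /\ weq M f.

Definition fib (a b : C) (f : hom a b) := rlp trivcof f.

Definition cofibrant (A : C) :=
  exists (I : C) (i : hom I A), is_initial I /\ cof M i.

Definition fibrant (T : C) :=
  exists (Z : C) (p : hom T Z), is_terminal Z /\ fib p.

End Model.

Record quillenAdjunction (C D : category) (M : modelData C) (N : modelData D)
    (F : functor C D) (U : functor D C) := QuillenAdjunction {
  quillen_adj :> adjunction F U;
  quillen_cof : forall a b (f : hom a b), cof M f -> cof N (fmor F f);
  quillen_trivcof : forall a b (f : hom a b),
    trivcof M f -> trivcof N (fmor F f)
}.

Definition quillen_equivalence (C D : category) (M : modelData C)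
    (N : modelData D) (F : functor C D) (U : functor D C)
    (Q : quillenAdjunction M N F U) :=
  forall (A : C) (T : D), cofibrant M A -> fibrant N T ->
  forall f : hom (F A) T, weq N f <-> weq M (transpose Q f).

Definition injective_model (C D : category) (M : modelData D) :
    modelData (functorCat C D) :=
  ModelData (fun (F G : functorCat C D) (f : hom F G) =>
               forall c : C, weq M (ntc f c))
            (fun (F G : functorCat C D) (f : hom F G) =>
               forall c : C, cof M (ntc f c)).

Definition left_induced (C D : category) (F : functor C D) (N : modelData D) :
    modelData C :=
  ModelData (fun a b (f : hom a b) => weq N (fmor F f))
            (fun a b (f : hom a b) => cof N (fmor F f)).

Definition SET : category :=
  @Category Type (fun a b => a -> b) (fun a x => x) (fun a b c g f x => g (f x))
    (fun a b f => erefl) (fun a b f => erefl) (fun a b c d h g f => erefl).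

(* The object [n] of the simplex category is the ordinal 'I_n.+1. *)
Record deltaHom (m n : nat) := DeltaHom {
  dfun :> 'I_m.+1 -> 'I_n.+1;
  dfun_homo : forall i j : 'I_m.+1, (i <= j)%N -> (dfun i <= dfun j)%N
}.

Lemma deltaHom_eq m n (f g : deltaHom m n) : (forall i, f i = g i) -> f = g.
Proof.
case: f g => [f fH] [g gH] /= fg.
have {}fg : f = g by apply/funext.
by subst g; congr DeltaHom; exact: Prop_irrelevance.
Qed.

Program Definition Delta : category :=
  @Category nat deltaHom (fun n => @DeltaHom n n id _)
    (fun a b c g f => @DeltaHom a c (g \o f) _) _ _ _.
Next Obligation. by []. Qed.
Next Obligation. by move=> a b c g f i j ij; do 2!apply: dfun_homo. Qed.
Next Obligation. by move=> *; apply: deltaHom_eq. Qed.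
Next Obligation. by move=> *; apply: deltaHom_eq. Qed.
Next Obligation. by move=> *; apply: deltaHom_eq. Qed.

Definition sSet : category := functorCat (op Delta) SET.

Definition simp (X : sSet) (n : nat) : Type := (X : functor _ _) n.

Definition sop (X : sSet) m n (th : deltaHom m n) (x : simp X n) : simp X m :=
  @fmor (op Delta) SET X n m th x.

Definition smap (X Y : sSet) (f : hom X Y) n (x : simp X n) : simp Y n :=
  ntc f n x.

Lemma sop_id (X : sSet) n (x : simp X n) : sop (@idm Delta n) x = x.
Proof.
exact: (congr1 (fun k => k x) (@fmor_id (op Delta) SET X n)).
Qed.

Lemma sop_comp (X : sSet) l m n (th : @hom Delta m n) (ph : @hom Delta l m)
  (x : simp X n) : sop (th \oc ph) x = sop ph (sop th x).
Proof.
exact: (congr1 (fun k => k x) (@fmor_comp (op Delta) SET X n m l ph th)).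
Qed.

Lemma smap_sop (X Y : sSet) (f : hom X Y) m n (th : deltaHom m n)
  (x : simp X n) : smap f (sop th x) = sop th (smap f x).
Proof. exact: (congr1 (fun k => k x) (@ntcE _ _ _ _ f n m th)). Qed.

Section Realization.
Local Open Scope ring_scope.
Variable R : realType.

Definition simplex (n : nat) : set 'rV[R]_n.+1 :=
  [set t | (forall i, 0 <= t 0 i) /\ \sum_i t 0 i = 1].
Arguments simplex n : clear implicits.

Definition push m n (th : deltaHom m n) (s : 'rV[R]_m.+1) :
  'rV[R]_n.+1 := \row_j \sum_(i | th i == j) s 0 i.

(* The coproduct of copies of the topological simplices, indexed by the
   simplices of X. *)
Definition prereal (X : sSet) : topologicalType :=
  {x : {classic {n : nat & simp X n}} & simplex (tag x)}.

Definition prept (X : sSet) n (x : simp X n) (t : simplex n) : prereal X :=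
  existT (fun y : {classic {n : nat & simp X n}} => simplex (tag y) : Type)
    (existT (simp X) n x) t.

Inductive glue (X : sSet) : prereal X -> prereal X -> Prop :=
  Glue m n (th : deltaHom m n) (x : simp X n) (s : simplex m) (t : simplex n) :
    \val t = push th (\val s) -> glue (prept (sop th x) s) (prept x t).

Definition glue_rel (X : sSet) : rel (prereal X) :=
  fun p q => `[< clos_refl_sym_trans _ (@glue X) p q >].

Lemma glue_refl X : reflexive (@glue_rel X).
Proof. by move=> p; apply/asboolP; apply: rst_refl. Qed.

Lemma glue_sym X : symmetric (@glue_rel X).
Proof.
by move=> p q; apply/asboolP/asboolP => pq; apply: rst_sym.
Qed.

Lemma glue_trans X : transitive (@glue_rel X).
Proof.
move=> q p r /asboolP pq /asboolP qr; apply/asboolP.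
exact: rst_trans pq qr.
Qed.

Definition glue_equiv (X : sSet) : equiv_rel (prereal X) :=
  EquivRel (@glue_rel X) (@glue_refl X) (@glue_sym X) (@glue_trans X).

Definition realization (X : sSet) : topologicalType :=
  quotient_topology {eq_quot (glue_equiv X)}.

Definition realpi (X : sSet) (p : prereal X) : realization X :=
  \pi_({eq_quot (glue_equiv X)}) p.

Definition prereal_map (X Y : sSet) (f : hom X Y) (p : prereal X) :
  prereal Y := prept (smap f (tagged (tag p))) (tagged p).

Definition realization_map (X Y : sSet) (f : hom X Y)
    (q : realization X) : realization Y :=
  realpi (prereal_map f (repr (q : {eq_quot (glue_equiv X)}))).

Lemma realization_mapE (X Y : sSet) (f : hom X Y) (p : prereal X) :
  realization_map f (realpi p) = realpi (prereal_map f p).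
Proof.
rewrite /realization_map /realpi; case: piP => q.
move=> /eqmodP /= /asboolP pq; apply/eqmodP => /=; apply/asboolP.
elim: pq => {p q} [_ _ [m n th x s t st]|p|p q _ IH|p q r _ IH1 _ IH2].
- apply: rst_sym; apply: rst_step.
  rewrite /prereal_map /= smap_sop; exact: Glue.
- exact: rst_refl.
- exact: rst_sym.
- exact: rst_trans IH2 IH1.
Qed.

Definition path_joined (X : topologicalType) (x y : X) :=
  exists p : R -> X,
    [/\ {within `[0, 1], continuous p}, p 0 = x & p 1 = y].

Definition cube (n : nat) : set 'rV[R]_n :=
  [set v | forall i, 0 <= v 0 i <= 1].
Arguments cube n : clear implicits.

Definition cube_boundary (n : nat) : set 'rV[R]_n :=
  [set v | cube n v /\ exists i, v 0 i = 0 \/ v 0 i = 1].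
Arguments cube_boundary n : clear implicits.

(* Maps are total functions on the ambient 'rV_n, of which only the
   restriction to the cube matters; [spheroid x a] says that a represents an
   element of pi_n(X, x), and [sph_homotopic x a b] that a and b represent the
   same one. *)
Definition spheroid (X : topologicalType) (x : X) n (a : 'rV[R]_n -> X) :=
  {within cube n, continuous a} /\ forall v, cube_boundary n v -> a v = x.

Definition sph_homotopic (X : topologicalType) (x : X) n
    (a b : 'rV[R]_n -> X) :=
  exists h : R * 'rV[R]_n -> X,
    [/\ {within `[0, 1] `*` cube n, continuous h},
        forall v, cube n v -> h (0, v) = a v,
        forall v, cube n v -> h (1, v) = b v &
        forall t v, 0 <= t <= 1 -> cube_boundary n v -> h (t, v) = x].

Definition pi0_bijective (X Y : topologicalType) (f : X -> Y) :=
  (forall x x', path_joined (f x) (f x') -> path_joined x x') /\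
  (forall y, exists x, path_joined (f x) y).

Definition pin_bijective (X Y : topologicalType) (f : X -> Y) n (x : X) :=
  (forall a a' : 'rV[R]_n -> X, spheroid x a -> spheroid x a' ->
     sph_homotopic (f x) (f \o a) (f \o a') -> sph_homotopic x a a') /\
  (forall b : 'rV[R]_n -> Y, spheroid (f x) b ->
     exists a, spheroid x a /\ sph_homotopic (f x) (f \o a) b).

Definition weak_homotopy_equiv (X Y : topologicalType) (f : X -> Y) :=
  pi0_bijective f /\ forall n (x : X), (0 < n)%N -> pin_bijective f n x.

End Realization.
Arguments simplex R n : clear implicits.
Arguments cube R n : clear implicits.
Arguments cube_boundary R n : clear implicits.

Definition KanQuillen (R : realType) : modelData sSet :=
  ModelData
    (fun (X Y : sSet) (f : hom X Y) =>
       weak_homotopy_equiv R (@realization_map R X Y f))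
    (fun (X Y : sSet) (f : hom X Y) => forall n, injective (@smap X Y f n)).

Section Orbits.
Local Open Scope group_scope.
Variables (gT : finGroupType) (F : pred {group gT}).

(* The set G/H of left cosets, where G is the full group of type gT. *)
Record cosetType (H : {group gT}) := Coset {
  cset :> {set gT};
  csetP : cset \in lcosets H [set: gT]%G
}.

Lemma coset_eq H (c d : cosetType H) : cset c = cset d -> c = d.
Proof.
case: c d => [c cP] [d dP] /= cd; subst d.
by congr Coset; exact: bool_irrelevance.
Qed.

Lemma lcoset_in (H : {group gT}) (g : gT) :
  g *: H \in lcosets H [set: gT]%G.
Proof. by apply/lcosetsP; exists g; rewrite ?inE. Qed.

Definition gcoset (H : {group gT}) (g : gT) : cosetType H :=
  Coset (lcoset_in H g).
Arguments gcoset : clear implicits.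

Lemma cosetW (H : {group gT}) (c : cosetType H) : exists g, c = gcoset H g.
Proof.
by case: c => c cP; have /lcosetsP [g _ cE] := cP; exists g; apply: coset_eq.
Qed.

Lemma coset_act_subproof (H : {group gT}) (g : gT) (c : cosetType H) :
  g *: cset c \in lcosets H [set: gT]%G.
Proof. by have [x ->] := cosetW c; rewrite /= -lcosetM lcoset_in. Qed.

Definition coset_act (H : {group gT}) (g : gT) (c : cosetType H) :=
  Coset (coset_act_subproof g c).

Lemma coset_actE (H : {group gT}) g x :
  coset_act g (gcoset H x) = gcoset H (g * x).
Proof. by apply: coset_eq; rewrite /= lcosetM. Qed.

Record orbObj := OrbObj { grp :> {group gT}; grpP : F grp }.

Record orbHom (H K : {group gT}) := OrbHom {
  ofun :> cosetType H -> cosetType K;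
  ofun_act : forall g c, ofun (coset_act g c) = coset_act g (ofun c)
}.

Lemma orbHom_eq H K (f f' : orbHom H K) :
  f (gcoset H 1) = f' (gcoset H 1) -> f = f'.
Proof.
case: f f' => [f fA] [f' f'A] /= ff'.
have {}ff' : f = f'.
  apply/funext => c; have [x ->] := cosetW c.
  by rewrite -[x]mulg1 -(coset_actE H) fA f'A ff'.
by subst f'; congr OrbHom; exact: Prop_irrelevance.
Qed.

Program Definition Orb : category :=
  @Category orbObj (fun H K => orbHom H K) (fun H => @OrbHom H H id _)
    (fun H K L g f => @OrbHom H L (g \o f) _) _ _ _.
Next Obligation. by []. Qed.
Next Obligation. by move=> H K L g f x c /=; rewrite !ofun_act. Qed.
Next Obligation. by move=> *; apply: orbHom_eq. Qed.
Next Obligation. by move=> *; apply: orbHom_eq. Qed.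
Next Obligation. by move=> *; apply: orbHom_eq. Qed.

Record gsSet := GsSet {
  gsset :> sSet;
  gact : forall n, simp gsset n -> gT -> simp gsset n;
  gact1 : forall n (a : simp gsset n), gact a 1 = a;
  gactM : forall n (a : simp gsset n) g h, gact a (g * h) = gact (gact a g) h;
  gact_sop : forall m n (th : deltaHom m n) (a : simp gsset n) g,
    sop th (gact a g) = gact (sop th a) g
}.

Record gsHom (A B : gsSet) := GsHom {
  gsmap :> @hom sSet A B;
  gsmap_act : forall n (a : simp A n) g,
    smap gsmap (gact a g) = gact (smap gsmap a) g
}.

Lemma gsHom_eq (A B : gsSet) (f g : gsHom A B) : gsmap f = gsmap g -> f = g.
Proof.
case: f g => [f fA] [g gA] /= fg; subst g.
by congr GsHom; exact: Prop_irrelevance.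
Qed.

Program Definition sSetG : category :=
  @Category gsSet gsHom (fun A => @GsHom A A (idm (A : sSet)) _)
    (fun A B C g f => @GsHom A C (gsmap g \oc gsmap f) _) _ _ _.
Next Obligation. by []. Qed.
Next Obligation.
move=> A B C g f n a x.
by rewrite -[LHS]/(smap g (smap f (gact a x))) !gsmap_act.
Qed.
Next Obligation. by move=> *; apply: gsHom_eq; exact: comp1m. Qed.
Next Obligation. by move=> *; apply: gsHom_eq; exact: compm1. Qed.
Next Obligation. by move=> *; apply: gsHom_eq; exact: compmA. Qed.

(* [a]_H, as the set of elements of the H-orbit of a *)
Definition orb (A : gsSet) (H : {group gT}) n (a : simp A n) :
  set (simp A n) := [set gact a h | h in [set` H]].

Record orbits (A : gsSet) (H : {group gT}) n := Orbits {
  oset :> set (simp A n);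
  osetP : exists a, oset = orb H a
}.

Definition orbcl (A : gsSet) (H : {group gT}) n (a : simp A n) :
  orbits A H n := Orbits (ex_intro (fun b => orb H a = orb H b) a erefl).

Lemma orbits_eq (A : gsSet) H n (S T : orbits A H n) : oset S = oset T -> S = T.
Proof.
case: S T => [S SP] [T TP] /= ST; subst T.
by congr Orbits; exact: Prop_irrelevance.
Qed.

Lemma orbitsW (A : gsSet) H n (S : orbits A H n) : exists a, S = orbcl H a.
Proof. by case: S => S [a aS]; exists a; apply: orbits_eq. Qed.

Lemma orbcl_eqP (A : gsSet) H n (a b : simp A n) :
  orbcl H a = orbcl H b <-> exists2 h, h \in H & b = gact a h.
Proof.
split=> [/(congr1 (@oset _ _ _))/= ab|[h hH ->]].
  have : orb H b b by exists 1; rewrite ?gact1 //= group1.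
  by rewrite -ab => -[h hH <-]; exists h.
apply: orbits_eq; rewrite /= /orb; apply/seteqP; split=> x [k /= kH <-].
  exists (h^-1 * k); first by rewrite /= groupM ?groupV.
  by rewrite -gactM mulKVg.
by exists (h * k); rewrite /= ?groupM // gactM.
Qed.

Lemma orbits_sop_orb (A : gsSet) H m n (th : deltaHom m n) (a : simp A n) :
  sop th @` orb H a = orb H (sop th a).
Proof.
apply/seteqP; split=> x.
  by case=> _ [h hH <-] <-; exists h; rewrite // gact_sop.
by case=> h hH <-; exists (gact a h); [exists h|rewrite gact_sop].
Qed.

Lemma orbits_sop_subproof (A : gsSet) H m n (th : deltaHom m n)
    (S : orbits A H n) : exists a, sop th @` S = orb H a.
Proof.
by have [a ->] := orbitsW S; exists (sop th a); exact: orbits_sop_orb.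
Qed.

Definition orbits_sop (A : gsSet) H m n (th : deltaHom m n)
    (S : orbits A H n) : orbits A H m := Orbits (orbits_sop_subproof th S).

Lemma orbits_sopE (A : gsSet) H m n (th : deltaHom m n) (a : simp A n) :
  orbits_sop th (orbcl H a) = orbcl H (sop th a).
Proof. by apply: orbits_eq; exact: orbits_sop_orb. Qed.

Program Definition quot (A : gsSet) (H : {group gT}) : sSet :=
  @Functor (op Delta) SET (fun n => orbits A H n)
    (fun n m th => @orbits_sop A H m n th) _ _.
Next Obligation.
move=> A H n; apply/funext => S /=; have [a ->] := orbitsW S.
by rewrite orbits_sopE sop_id.
Qed.
Next Obligation.
move=> A H n m l ph th; apply/funext => S /=; have [a ->] := orbitsW S.
by rewrite !orbits_sopE -sop_comp.
Qed.

(* For f : G/H -> G/K with f(H) = gK, the K-orbit of a * g is the set of all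
   products of an element of the H-orbit of a by an element of gK. This gives
   theta_!(f)([a]_H) = [a * g]_K without choosing a or g; see quot_mapE. *)
Lemma quot_map_orb (A : gsSet) (H K : {group gT}) (f : orbHom H K) g n
    (a : simp A n) :
  f (gcoset H 1) = gcoset K g ->
  [set x | exists b h, [/\ orb H a b, h \in cset (f (gcoset H 1)) &
                           x = gact b h]] = orb K (gact a g).
Proof.
move=> fg; apply/seteqP; split=> x.
  case=> _ [k [[h hH <-] kf ->]].
  have fh : coset_act h (f (gcoset H 1)) = f (gcoset H 1).
    rewrite -ofun_act coset_actE mulg1; congr (f _).
    by apply: coset_eq; rewrite /= !lcoset_id // group1.
  have : h * k \in cset (coset_act h (f (gcoset H 1))).
    by rewrite /= mem_lcoset mulKg.
  rewrite fh fg /= => /lcosetP [l lK hkl]; exists l => //.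
  by rewrite -!gactM hkl.
case=> k kK <-; exists a, (g * k); split; last by rewrite -gactM.
- by exists 1; rewrite ?gact1 //= group1.
- by rewrite fg /= mem_lcoset mulKg.
Qed.

Lemma quot_map_subproof (A : gsSet) (H K : {group gT}) (f : orbHom H K) n
    (S : orbits A H n) :
  exists a, [set x | exists b h, [/\ oset S b, h \in cset (f (gcoset H 1)) &
                           x = gact b h]] = orb K a.
Proof.
have [a ->] := orbitsW S; have [g fg] := cosetW (f (gcoset H 1)).
by exists (gact a g); exact: quot_map_orb.
Qed.

Definition quot_fun (A : gsSet) (H K : {group gT}) (f : orbHom H K) n
    (S : orbits A H n) : orbits A K n := Orbits (quot_map_subproof f S).

Lemma quot_funE (A : gsSet) (H K : {group gT}) (f : orbHom H K) g n
    (a : simp A n) :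
  f (gcoset H 1) = gcoset K g ->
  quot_fun f (orbcl H a) = orbcl K (gact a g).
Proof. by move=> fg; apply: orbits_eq; exact: quot_map_orb. Qed.

Program Definition quot_map (A : gsSet) (H K : {group gT}) (f : orbHom H K) :
    hom (quot A H) (quot A K) :=
  @NatTrans (op Delta) SET (quot A H) (quot A K) (fun n => @quot_fun A H K f n)
    _.
Next Obligation.
move=> A H K f n m th; apply/funext => S /=; have [a ->] := orbitsW S.
have [g fg] := cosetW (f (gcoset H 1)).
by rewrite orbits_sopE !(quot_funE _ fg) orbits_sopE gact_sop.
Qed.

Lemma quot_mapE (A : gsSet) (H K : {group gT}) (f : orbHom H K) g n
    (a : simp A n) :
  f (gcoset H 1) = gcoset K g ->
  smap (quot_map A f) (orbcl H a) = orbcl K (gact a g).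
Proof. exact: quot_funE. Qed.

Program Definition theta_lower_obj (A : gsSet) : functorCat Orb sSet :=
  @Functor Orb sSet (fun H => quot A H) (fun H K f => quot_map A f) _ _.
Next Obligation.
move=> A H; apply: natTrans_eq => n; apply/funext => S /=.
have [a ->] := orbitsW S.
by rewrite (@quot_funE _ _ _ _ 1) // gact1.
Qed.
Next Obligation.
move=> A H K L f' f; apply: natTrans_eq => n; apply/funext => S /=.
have [a ->] := orbitsW S.
have [g fg] := cosetW (f (gcoset H 1)).
have [g' fg'] := cosetW (f' (gcoset K 1)).
rewrite (quot_funE _ fg) (quot_funE _ fg') -gactM; apply: quot_funE => /=.
by rewrite fg -[g in LHS]mulg1 -(coset_actE K) ofun_act fg' coset_actE.
Qed.

Lemma orbits_map_orb (A B : gsSet) (f : gsHom A B) H n (a : simp A n) :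
  @smap A B f n @` orb H a = orb H (smap f a).
Proof.
apply/seteqP; split=> x.
  by case=> _ [h hH <-] <-; exists h; rewrite // gsmap_act.
by case=> h hH <-; exists (gact a h); [exists h|rewrite gsmap_act].
Qed.

Lemma orbits_map_subproof (A B : gsSet) (f : gsHom A B) H n
    (S : orbits A H n) : exists b, @smap A B f n @` S = orb H b.
Proof.
by have [a ->] := orbitsW S; exists (smap f a); exact: orbits_map_orb.
Qed.

Definition orbits_map (A B : gsSet) (f : gsHom A B) H n (S : orbits A H n) :
  orbits B H n := Orbits (orbits_map_subproof f S).

Lemma orbits_mapE (A B : gsSet) (f : gsHom A B) H n (a : simp A n) :
  orbits_map f (orbcl H a) = orbcl H (smap f a).
Proof. by apply: orbits_eq; exact: orbits_map_orb. Qed.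

Program Definition theta_lower_comp (A B : gsSet) (f : gsHom A B) H :
    hom (quot A H) (quot B H) :=
  @NatTrans (op Delta) SET (quot A H) (quot B H)
    (fun n => @orbits_map A B f H n) _.
Next Obligation.
move=> A B f H n m th; apply/funext => S /=; have [a ->] := orbitsW S.
by rewrite orbits_sopE !orbits_mapE orbits_sopE smap_sop.
Qed.

Program Definition theta_lower_mor (A B : gsSet) (f : gsHom A B) :
    hom (theta_lower_obj A) (theta_lower_obj B) :=
  @NatTrans Orb sSet (theta_lower_obj A) (theta_lower_obj B)
    (fun H => theta_lower_comp f H) _.
Next Obligation.
move=> A B f H K u; apply: natTrans_eq => n; apply/funext => S /=.
have [a ->] := orbitsW S.
have [g ug] := cosetW (u (gcoset H 1)).
by rewrite !orbits_mapE !(quot_funE _ ug) orbits_mapE gsmap_act.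
Qed.

Program Definition theta_lower : functor sSetG (functorCat Orb sSet) :=
  @Functor sSetG (functorCat Orb sSet) theta_lower_obj theta_lower_mor _ _.
Next Obligation.
move=> A; do 2!apply: natTrans_eq => ?; apply/funext => S /=.
by have [a ->] := orbitsW S; rewrite orbits_mapE.
Qed.
Next Obligation.
move=> A B C g f; do 2!apply: natTrans_eq => ?; apply/funext => S /=.
by have [a ->] := orbitsW S; rewrite !orbits_mapE.
Qed.

Section ThetaUpper.
Hypothesis F1 : F 1%G.

Definition orb1 : Orb := OrbObj F1.

(* [orb_proj H g] is the map g~ : G/{e} -> G/H sending {e} to gH. *)
Definition orb_proj_fun (H : {group gT}) (g : gT) (c : cosetType 1%G) :
  cosetType H := gcoset H (fingroup.repr (cset c) * g).

Lemma repr_coset1 x : fingroup.repr (cset (gcoset 1%G x)) = x.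
Proof.
have : fingroup.repr (x *: 1%G) \in x *: 1%G.
  by rewrite (mem_repr x) ?lcoset_refl.
by rewrite mem_lcoset => /set1P /(canRL (mulKVg x)) ->; rewrite mulg1.
Qed.

Lemma orb_proj_funE H g x :
  orb_proj_fun H g (gcoset 1%G x) = gcoset H (x * g).
Proof. by rewrite /orb_proj_fun repr_coset1. Qed.

Lemma orb_proj_act H g x c :
  orb_proj_fun H g (coset_act x c) = coset_act x (orb_proj_fun H g c).
Proof.
have [y ->] := cosetW c.
by rewrite coset_actE !orb_proj_funE coset_actE mulgA.
Qed.

Definition orb_proj (H : Orb) (g : gT) : hom orb1 H :=
  OrbHom (@orb_proj_act H g).

Lemma orb_projE (H : Orb) g x :
  orb_proj H g (gcoset 1%G x) = gcoset H (x * g).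
Proof. exact: orb_proj_funE. Qed.

Lemma orb_proj1 : orb_proj orb1 1 = idm orb1.
Proof. by apply: orbHom_eq; rewrite orb_projE mulg1. Qed.

Lemma orb_proj_comp (H : Orb) g h :
  orb_proj H h \oc orb_proj orb1 g = orb_proj H (g * h).
Proof.
apply: orbHom_eq.
rewrite -[LHS]/(orb_proj H h (orb_proj orb1 g (gcoset 1%G 1))).
by rewrite !orb_projE mulgA.
Qed.

Lemma comp_orb_proj (H K : Orb) (u : hom H K) g h :
  u (gcoset H 1) = gcoset K g -> u \oc orb_proj H h = orb_proj K (h * g).
Proof.
move=> ug; apply: orbHom_eq.
rewrite -[LHS]/(u (orb_proj H h (gcoset 1%G 1))) !orb_projE !mul1g.
by rewrite -[h in LHS]mulg1 -(coset_actE H) ofun_act ug coset_actE.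
Qed.

Program Definition theta_upper_obj (T : functorCat Orb sSet) : gsSet :=
  @GsSet ((T : functor _ _) orb1)
    (fun n a g => smap (fmor (T : functor _ _) (orb_proj orb1 g)) a) _ _ _.
Next Obligation.
by move=> T n a /=; rewrite orb_proj1 fmor_id.
Qed.
Next Obligation.
by move=> T n a g h /=; rewrite -orb_proj_comp fmor_comp.
Qed.
Next Obligation. by move=> T m n th a g /=; rewrite smap_sop. Qed.

Program Definition theta_upper_mor (T T' : functorCat Orb sSet)
    (f : hom T T') : gsHom (theta_upper_obj T) (theta_upper_obj T') :=
  @GsHom (theta_upper_obj T) (theta_upper_obj T') (ntc f orb1) _.
Next Obligation.
move=> T T' f n a g.
have := @ntcE _ _ _ _ f orb1 orb1 (orb_proj orb1 g).
by move=> /(congr1 (fun k => smap k a)).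
Qed.

Program Definition theta_upper : functor (functorCat Orb sSet) sSetG :=
  @Functor (functorCat Orb sSet) sSetG theta_upper_obj theta_upper_mor _ _.
Next Obligation. by move=> T; apply: gsHom_eq. Qed.
Next Obligation. by move=> T T' T'' g f; apply: gsHom_eq. Qed.

(* The adjunct of f is its component at G/{e}, composed with the bijection
   a |-> [a]_{e} from A to A/{e}. *)
Program Definition theta_transpose_map (A : gsSet) (T : functorCat Orb sSet)
    (f : hom (theta_lower A) T) : @hom sSet A (theta_upper_obj T) :=
  @NatTrans (op Delta) SET (gsset A) (gsset (theta_upper_obj T))
    (fun n a => smap (ntc f orb1) (orbcl 1%G a)) _.
Next Obligation.
move=> A T f n m th; apply/funext => a /=.
rewrite -[RHS]/(sop th (smap (ntc f orb1) (orbcl 1%G a))) -smap_sop.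
by congr smap; exact/esym/orbits_sopE.
Qed.

Program Definition theta_transpose (A : sSetG) (T : functorCat Orb sSet)
    (f : hom (theta_lower A) T) : hom A (theta_upper T) :=
  @GsHom A (theta_upper T) (theta_transpose_map f) _.
Next Obligation.
move=> A T f n a g.
rewrite -[LHS]/(smap (ntc f orb1) (orbcl 1%G (gact a g))).
rewrite -(@quot_mapE _ _ _ (orb_proj orb1 g)); last by rewrite orb_projE mul1g.
have := @ntcE _ _ _ _ f orb1 orb1 (orb_proj orb1 g).
by move=> /(congr1 (fun k => smap k (orbcl 1%G a : simp (quot A 1%G) n))).
Qed.

Section Untranspose.
Variables (A : sSetG) (T : functorCat Orb sSet) (f : hom A (theta_upper T)).

Definition untr_fun (H : Orb) n (S : orbits A H n) :
    simp ((T : functor _ _) H) n :=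
  smap (fmor (T : functor _ _) (orb_proj H 1))
    (smap (gsmap f) (projT1 (cid (osetP S)))).

Lemma untr_funE (H : Orb) n (a : simp A n) :
  untr_fun (orbcl H a) =
  smap (fmor (T : functor _ _) (orb_proj H 1)) (smap (gsmap f) a).
Proof.
rewrite /untr_fun; case: cid => b /= ab.
have /orbcl_eqP [h hH ->] : orbcl H b = orbcl H a by exact: orbits_eq.
rewrite (gsmap_act f b h) /=.
rewrite -[RHS]/(smap (fmor (T : functor _ _) (orb_proj H 1) \oc
  fmor (T : functor _ _) (orb_proj orb1 h)) (smap (gsmap f) b)).
rewrite -fmor_comp orb_proj_comp mulg1.
have -> : orb_proj H h = orb_proj H 1; last by [].
apply: orbHom_eq; rewrite !orb_projE !mul1g.
by apply: coset_eq; rewrite /= !lcoset_id // group1.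
Qed.

Program Definition untr_comp (H : Orb) :
    hom (quot A H) ((T : functor _ _) H : sSet) :=
  @NatTrans (op Delta) SET (quot A H) ((T : functor _ _) H)
    (fun n => @untr_fun H n) _.
Next Obligation.
move=> H n m th; apply/funext => S /=; have [a ->] := orbitsW S.
rewrite -[RHS]/(sop th (untr_fun (orbcl H a))).
by rewrite orbits_sopE !untr_funE !smap_sop.
Qed.

Program Definition untranspose : hom (theta_lower A) T :=
  @NatTrans Orb sSet (theta_lower_obj A) T untr_comp _.
Next Obligation.
move=> H K u; apply: natTrans_eq => n; apply/funext => S /=.
have [a ->] := orbitsW S; have [g ug] := cosetW (u (gcoset H 1)).
rewrite (quot_funE _ ug) untr_funE.
rewrite -[RHS]/(smap (fmor (T : functor _ _) u) (untr_fun (orbcl H a))).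
rewrite untr_funE (gsmap_act f a g) /=.
rewrite -[LHS]/(smap (fmor (T : functor _ _) (orb_proj K 1) \oc
  fmor (T : functor _ _) (orb_proj orb1 g)) (smap (gsmap f) a)).
rewrite -[RHS]/(smap (fmor (T : functor _ _) u \oc
  fmor (T : functor _ _) (orb_proj H 1)) (smap (gsmap f) a)).
by rewrite -!fmor_comp orb_proj_comp (comp_orb_proj _ ug) mulg1 mul1g.
Qed.

End Untranspose.

Lemma theta_transpose_bij (A : sSetG) (T : functorCat Orb sSet) :
  bijective (@theta_transpose A T).
Proof.
exists (@untranspose A T) => f.
  apply: natTrans_eq => H; apply: natTrans_eq => n; apply/funext => S.
  have [a ->] := orbitsW S.
  rewrite -[LHS]/(untr_fun (theta_transpose f) (orbcl H a)) untr_funE.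
  rewrite -[smap (gsmap _) a]/(smap (ntc f orb1) (orbcl 1%G a)).
  have := @ntcE _ _ _ _ f orb1 H (orb_proj H 1).
  move=> /(congr1 (fun k => smap k (orbcl 1%G a : simp (quot A 1%G) n))).
  rewrite -[smap (fmor T _ \oc _) _]/(smap (fmor (T : functor _ _)
    (orb_proj H 1)) (smap (ntc f orb1) (orbcl 1%G a))) => <-.
  rewrite -[LHS]/(smap (ntc f H) (smap (quot_map A (orb_proj H 1))
    (orbcl 1%G a))).
  by rewrite (@quot_mapE _ _ _ _ 1) ?gact1 // orb_projE mulg1.
apply: gsHom_eq; apply: natTrans_eq => n; apply/funext => a.
rewrite -[LHS]/(untr_fun f (orbcl orb1 a)) untr_funE.
by rewrite orb_proj1 fmor_id.
Qed.

Lemma theta_transpose_natl (A A' : sSetG) (T : functorCat Orb sSet)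
    (f : hom (theta_lower A') T) (h : hom A A') :
  theta_transpose (f \oc fmor theta_lower h) = theta_transpose f \oc h.
Proof.
apply: gsHom_eq; apply: natTrans_eq => n; apply/funext => a.
rewrite -[LHS]/(smap (ntc f orb1) (orbits_map h (orbcl 1%G a))).
by rewrite orbits_mapE.
Qed.

Lemma theta_transpose_natr (A : sSetG) (T T' : functorCat Orb sSet)
    (k : hom T T') (f : hom (theta_lower A) T) :
  theta_transpose (k \oc f) = fmor theta_upper k \oc theta_transpose f.
Proof. by apply: gsHom_eq; apply: natTrans_eq. Qed.

Definition theta_adjunction : adjunction theta_lower theta_upper :=
  Adjunction theta_transpose_bij theta_transpose_natl theta_transpose_natr.

Variable R : realType.

Definition OrbInj : modelData (functorCat Orb sSet) :=
  injective_model Orb (KanQuillen R).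

Definition sSetG_F : modelData sSetG := left_induced theta_lower OrbInj.

Definition theta_quillen :
    quillenAdjunction sSetG_F OrbInj theta_lower theta_upper :=
  @QuillenAdjunction _ _ sSetG_F OrbInj _ _ theta_adjunction
    (fun a b f cf => cf) (fun a b f tf => tf).

End ThetaUpper.
End Orbits.

(* Main.v *)
Require Import Defs.
From mathcomp Require Import all_boot all_algebra all_fingroup.
From mathcomp Require Import generic_quotient.
From mathcomp Require Import all_classical reals topology.

(** Let T be the subterminal diagram with T(G/{e}) empty and T(G/H) a point for
    H nontrivial; it is a functor because no G/H with H nontrivial maps to
    G/{e}. It is injectively fibrant: if P -> Q is a trivial cofibration and P
    maps to T, then P(G/{e}) is empty, hence so is the weakly equivalent
    Q(G/{e}), and Q maps to T. Now theta^* T is empty, so the map from the empty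
    G-simplicial set to theta^* T is an isomorphism, while its adjunct is the
    map from the empty diagram to T, which is not a weak equivalence at G/G. *)

Set Implicit Arguments.
Unset Strict Implicit.
Unset Printing Implicit Defensive.

Import GRing.Theory Num.Theory Defs.

Local Open Scope quotient_scope.

(** A point of the realization is a class of points lying in simplices of [X], and each simplex of
    [X] contributes at least one point. *)
Lemma realization_inhabited (R : realType) (X : sSet) :
  inhabited (realization R X) <-> exists n, inhabited (simp X n).
Proof.
split=> [[q]|[n [x]]].
  have [[n x] _] := generic_quotient.repr (q : {eq_quot (glue_equiv R X)}).
  by exists n.
(* The chosen point is the vertex of the topological simplex indexed by [ord0]. *)
have v_simplex : simplex R n (\row_j (j == ord0)%:R)%R.
  split=> [i|]; first by rewrite mxE ler0n.
  rewrite (bigD1 ord0) //= mxE eqxx big1 ?addr0 // => i /negbTE i0.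
  by rewrite mxE i0.
exact: (inhabits (realpi (prept x (SigSub (mem_set v_simplex))))).
Qed.

(** Surjectivity on path components yields a point of [X] from one of [Y]. *)
Lemma weak_homotopy_equiv_inhabited (R : realType) (X Y : topologicalType)
    (f : X -> Y) :
  weak_homotopy_equiv R f -> inhabited X <-> inhabited Y.
Proof.
move=> [[_ f_surj] _]; split=> -[x]; first by constructor; exact: f x.
by have [y _] := f_surj x.
Qed.

(** The source is then empty too, so every condition holds vacuously. *)
Lemma weak_homotopy_equiv_empty (R : realType) (X Y : topologicalType)
    (f : X -> Y) :
  ~ inhabited Y -> weak_homotopy_equiv R f.
Proof.
move=> Y0; have X0 (x : X) : False by apply: Y0; constructor; exact: f x.
split=> [|n x]; last by case: (X0 x).
by split=> [x|y]; [case: (X0 x)|case: Y0].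
Qed.

Lemma KanQuillen_inhabited (R : realType) (X Y : sSet) (f : hom X Y) :
  weq (KanQuillen R) f ->
  (exists n, inhabited (simp X n)) <-> (exists n, inhabited (simp Y n)).
Proof.
move=> /weak_homotopy_equiv_inhabited; rewrite -!(realization_inhabited R).
exact.
Qed.

Lemma KanQuillen_empty (R : realType) (X Y : sSet) (f : hom X Y) :
  (forall n, simp Y n -> False) -> weq (KanQuillen R) f.
Proof.
move=> Y0; apply: weak_homotopy_equiv_empty.
by rewrite realization_inhabited => -[n [y]]; exact: Y0 y.
Qed.

Lemma fun_Prop_eq (A : Type) (P : Prop) (f g : A -> P) : f = g.
Proof. by apply/funext => a; exact: Prop_irrelevance. Qed.

(* The set of n-simplices is P itself, viewed as the type of its proofs. *)
Definition propS (P : Prop) : sSet :=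
  @Functor (op Delta) SET (fun _ => P) (fun _ _ _ p => p)
    (fun _ => erefl) (fun _ _ _ _ _ => erefl).

Definition toPropS (X : sSet) (P : Prop) (XP : forall n, simp X n -> P) :
    hom X (propS P) :=
  @NatTrans (op Delta) SET X (propS P) XP
    (fun _ _ _ => @fun_Prop_eq _ P _ _).

Lemma hom_propS_eq (X : sSet) (P : Prop) (f g : hom X (propS P)) : f = g.
Proof.
by apply: natTrans_eq => n; exact: (@fun_Prop_eq _ P).
Qed.

Section Subterminal.
Variable C : category.

(** [Pmor] makes [P] a cosieve; cosieves correspond to the subobjects of the terminal diagram. *)
Definition subterminal (P : C -> Prop)
    (Pmor : forall a b : C, hom a b -> P a -> P b) : functorCat C sSet :=
  @Functor C sSet (fun a => propS (P a))
    (fun a b u => @toPropS (propS (P a)) (P b) (fun _ => Pmor a b u))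
    (fun _ => hom_propS_eq _ _) (fun _ _ _ _ _ => hom_propS_eq _ _).

Definition to_subterminal (T : functorCat C sSet) (P : C -> Prop) Pmor
    (TP : forall a n, simp ((T : functor _ _) a) n -> P a) :
    hom T (subterminal (P := P) Pmor) :=
  @NatTrans C sSet T (subterminal Pmor) (fun a => toPropS (TP a))
    (fun _ _ _ => hom_propS_eq _ _).

Lemma hom_subterminal_eq (T : functorCat C sSet) (P : C -> Prop) Pmor
    (f g : hom T (subterminal (P := P) Pmor)) : f = g.
Proof. by apply: natTrans_eq => a; exact: hom_propS_eq. Qed.

Lemma subterminalT :
  is_terminal (subterminal (P := fun=> True) (fun _ _ _ _ => I)).
Proof.
move=> T; exists (to_subterminal (P := fun=> True) _ (fun _ _ _ => I)).
by split=> // f _; exact: hom_subterminal_eq.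
Qed.

Lemma subterminal_fibrant (R : realType) (P : C -> Prop) Pmor :
  fibrant (injective_model C (KanQuillen R)) (subterminal (P := P) Pmor).
Proof.
exists (subterminal (P := fun=> True) (fun _ _ _ _ => I)).
exists (to_subterminal (P := fun=> True) _ (fun _ _ _ => I)).
split=> [|A B i u v [_ i_weq] _]; first exact: subterminalT.
have BP a n (b : simp ((B : functor _ _) a) n) : P a.
  (* Since [i] is a weak equivalence at [a], the simplex [b] forces a simplex of [A] at [a], which
     [u] sends to a proof of [P a]. *)
  have [_ /(_ (ex_intro _ n (inhabits b)))] := KanQuillen_inhabited (i_weq a).
  move=> [m [x]].
  exact: (@smap ((A : functor _ _) a) (propS (P a)) (ntc u a) m x).
by exists (to_subterminal Pmor BP); split; exact: hom_subterminal_eq.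
Qed.

End Subterminal.

Section EmptyGSet.
Variables (gT : finGroupType) (F : pred {group gT}).

Definition emptyG : gsSet gT :=
  @GsSet gT (propS False) (fun _ a _ => a) (fun _ _ => erefl)
    (fun _ _ _ _ => erefl) (fun _ _ _ _ _ => erefl).

Definition from_emptyG (A : sSetG gT) : @hom (sSetG gT) emptyG A :=
  @GsHom gT emptyG A
    (@NatTrans (op Delta) SET (propS False) (gsset A)
      (fun _ => False_rect _)
      (fun _ _ _ => funext (fun a => False_ind _ a)))
    (fun _ a => False_ind _ a).

Lemma emptyG_initial : @is_initial (sSetG gT) emptyG.
Proof.
move=> A; exists (from_emptyG A); split=> // f _.
by apply: gsHom_eq; apply: natTrans_eq => n; apply/funext => -[].
Qed.

Lemma quot_empty (A : gsSet gT) (H : {group gT}) :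
  (forall n, simp A n -> False) -> forall n, simp (quot A H) n -> False.
Proof. by move=> A0 n S; have [a _] := orbitsW S; exact: A0 a. Qed.

Lemma emptyG_cofibrant (R : realType) : cofibrant (sSetG_F F R) emptyG.
Proof.
exists emptyG, (@idm (sSetG gT) emptyG); split; first exact: emptyG_initial.
by move=> H n S; case: (quot_empty (A := emptyG) (fun _ => id) S).
Qed.

End EmptyGSet.

Section NotQuillenEquivalence.
Variables (gT : finGroupType) (F : pred {group gT}) (F1 : F 1%G).

(** The image [xK] of the coset [H] is fixed by [H]. If [K] is trivial, [hx = x] for all [h] in [H],
    so [H] is trivial. *)
Lemma orbHom_nontrivial (H K : Orb F) :
  hom H K -> grp H != 1%G -> grp K != 1%G.
Proof.
move=> u; apply: contraNneq => K1.
apply/eqP/group_inj/trivgP/fintype.subsetP => h hH.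
have [x ux] := cosetW (ofun u (gcoset (grp H) 1%g)).
have : coset_act h (ofun u (gcoset H 1%g)) = ofun u (gcoset H 1%g).
  rewrite -ofun_act coset_actE mulg1; congr (ofun u _).
  by apply: coset_eq; rewrite /= !lcoset_id // group1.
rewrite ux coset_actE => /(congr1 (fun c => cset c)) /= hx.
have : (h * x)%g \in (x *: grp K)%g by rewrite -hx lcoset_refl.
rewrite K1 mem_lcoset => /set1P /(canRL (mulKVg x)); rewrite mulg1 => e.
by apply/set1P; apply: (mulIg x); rewrite mul1g.
Qed.

Definition nontrivial_diagram : functorCat (Orb F) sSet :=
  subterminal (P := fun H : Orb F => grp H != 1%G) orbHom_nontrivial.

Lemma theta_not_quillen_equivalence (R : realType) (H : {group gT}) :
  F H -> H != 1%G -> ~ quillen_equivalence (theta_quillen F1 R).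
Proof.
move=> FH H1 QE.
have lower_empty K n : simp (quot (emptyG gT) K) n -> False.
  exact: (quot_empty (A := emptyG gT) (fun _ => id)).
pose f : hom (theta_lower F (emptyG gT)) nontrivial_diagram :=
  to_subterminal orbHom_nontrivial
    (T := theta_lower F (emptyG gT))
    (fun K n S => False_ind _ (lower_empty K n S)).
have [_ weq_f] := QE _ _ (emptyG_cofibrant F R)
  (subterminal_fibrant R orbHom_nontrivial) f.
(* The adjunct has empty target, because a simplex there is a proof that the trivial group is
   nontrivial. So [f] would be a weak equivalence, in particular at [G/H]. *)
have /weq_f /(_ (OrbObj FH)) /KanQuillen_inhabited [_] :
    weq (sSetG_F F R) (transpose (theta_quillen F1 R) f).
  move=> K; apply: KanQuillen_empty.
  apply: (quot_empty (A := theta_upper F1 nontrivial_diagram)) => n.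
  by rewrite /simp /= eqxx.
(* At [G/H] the target of [f] is a point and its source is empty. *)
by move=> [|n [S]]; [exists 0; constructor|exact: lower_empty S].
Qed.

End NotQuillenEquivalence.

Theorem mainTheorem4 (R : realType) :
  ~ quillen_equivalence (theta_quillen (gT := 'Z_2) (F := xpredT) isT R).
Proof.
(* The nontrivial subgroup is the whole group, of order 2. *)
apply: (@theta_not_quillen_equivalence _ _ _ _ [set: 'Z_2]%G) => //.
apply/eqP => /(congr1 (fun A : {group 'Z_2} => #|A|)).
by rewrite cardsT card_ord cards1.
Qed.
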